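(* Let $N\in\mathbb{N}$, write $N=2k$ or $N=2k+1$, let $w_0,\dotsc,w_{N-1}\ge0$, and consider a gathering Circulant Laplacian Dynamics (CLD) protocol with weight matrix $W=\operatorname{circ}(w_0,\dotsc,w_{N-1})\in\mathbb{R}^{N\times N}$, i.e. the linear system on $\mathbb{R}^{2N}$ $$\dot Z=(-\mathbf{I}_{2N}+\mathbf{W})Z,\qquad \mathbf{W}=\begin{pmatrix}W&0\\0&W\end{pmatrix}.$$ Let $\omega=\exp(2\pi \mathbf{i}/N)$, $v_j=(1,\omega^j,\omega^{2j},\dotsc,\omega^{(N-1)j})^T\in\mathbb{C}^N$ and $\lambda_j=\sum_{i=0}^{N-1}w_i\omega^{ij}\in\mathbb{C}$ (so $Wv_j=\lambda_jv_j$). Let $$V_0=\{(x^*,\dotsc,x^*,y^*,\dotsc,y^* )\;:\;x^*,y^*\in\mathbb{R}\}\subseteq\mathbb{R}^{2N}$$ be the $2$-dimensional subspace of gathering points and, for $j=1,\dotsc,k$, let $V_j\subseteq\mathbb{R}^{2N}$ be the subspace generated by $v_j$, namely $$V_j=\operatorname{span}\left(\begin{pmatrix}\Re(v_j)\\-\Im(v_j)\end{pmatrix},\begin{pmatrix}\Im(v_j)\\\Re(v_j)\end{pmatrix},\begin{pmatrix}-\Im(v_j)\\\Re(v_j)\end{pmatrix},\begin{pmatrix}\Re(v_j)\\\Im(v_j)\end{pmatrix}\right).$$ Then each $V_j$, $j=1,\dotsc,k$, is a stable invariant subspace with convergence rate $\Re(\lambda_j)<1$, and $$\mathbb{R}^{2N}=V_0\oplus\bigoplus_{j=1}^kV_j,$$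 where (i) if $N=2k+1$ is odd, every $V_j$, $j=1,\dotsc,k$, is $4$-dimensional; (ii) if $N=2k$ is even, $V_k$ is $2$-dimensional and the remaining $V_j$, $1\le j\le k-1$, are $4$-dimensional. The decomposition is identical for every gathering CLD protocol of $N$ robots (the subspaces do not depend on $W$); only the values of the convergence rates $\Re(\lambda_j)$ depend on the protocol.
   Context: $N$ robots with positions $z_i=(x_i,y_i)\in\mathbb{R}^2$, $i=0,\dotsc,N-1$, are collected in $Z=(X,Y)\in\mathbb{R}^{2N}$ with $X=(x_0,\dotsc,x_{N-1})$, $Y=(y_0,\dotsc,y_{N-1})$. The CLD protocol is $\dot z_i=-z_i+\sum_{j=0}^{N-1}w_jz_{i+j}$, indices modulo $N$; equivalently the system in the claim. $\operatorname{circ}(w_0,\dotsc,w_{N-1})$ is the circulant matrix with entries $W_{i,j}=w_{(j-i)\bmod N}$. All weights are non-negative (standing assumption). $\Re$ and $\Im$ of a vector are taken entrywise. The protocol is called gathering if, for every initial configuration, the solution converges as $t\to\infty$ to a gathering point (there is $z^*\in\mathbb{R}^2$ with $z_i(t)\to z^*$ for all $i$) and if the system is in equilibrium in every gathering point ($\dot z_i=0$ for all $i$ whenever $z_0=\dotsb=z_{N-1}$). For $j\ne 0$, ''$V_j$ is a stable invariant subspace with convergence rate $\Re(\lambda_j)<1$'' means: every solution $Z(t)$ with $Z(0)\in V_j$ stays in $V_j$ for all $t\ge0$ and converges to $0$ with exponential decay rate $-1+\Re(\lambda_j)<0$, i.e. there are constants $0<c\le C$ with $c\,e^{(-1+\Re(\lambda_j))t}\|Z(0)\|\le\|Z(t)\|\le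 C\,e^{(-1+\Re(\lambda_j))t}\|Z(0)\|$ for all $t\ge0$ and all such solutions. *)

(* Defs.v *)
From HB Require Import structures.
From mathcomp Require Import all_boot all_order all_algebra.
From mathcomp Require Import complex.
From mathcomp Require Import all_classical all_reals all_analysis.

Set Implicit Arguments.
Unset Strict Implicit.
Unset Printing Implicit Defensive.

Import Order.TTheory GRing.Theory Num.Theory.
Import numFieldNormedType.Exports.

Local Open Scope classical_set_scope.
Local Open Scope ring_scope.

(* (j - i) mod N; the subtraction N - i is not truncated since i < N *)
Definition subord_mod N (i j : 'I_N) : 'I_N :=
  Ordinal (ltn_pmod (j + (N - i))%N (leq_ltn_trans (leq0n i) (ltn_ord i))).

Definition circ (R : realType) N (w : 'I_N -> R) : 'M[R]_N :=
  \matrix_(i, j) w (subord_mod i j).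

(* A configuration is a column vector Z = (X, Y) with X, Y in R^N, and
   robot i has position z_i = (xpos Z i, ypos Z i). *)
Definition xpos (R : realType) N (Z : 'cV[R]_(N + N)) (i : 'I_N) : R :=
  usubmx Z i 0.

Definition ypos (R : realType) N (Z : 'cV[R]_(N + N)) (i : 'I_N) : R :=
  dsubmx Z i 0.

Definition cld_matrix (R : realType) N (w : 'I_N -> R) : 'M[R]_(N + N) :=
  - 1%:M + block_mx (circ w) 0 0 (circ w).

(* Z' = A Z on [0, +oo[ : differentiability on ]0, +oo[ and right continuity
   at 0, no condition being put on the values Z t for t < 0. *)
Definition is_solution (R : realType) n (A : 'M[R]_n) (Z : R -> 'cV[R]_n) :
    Prop :=
  (forall t : R, 0 < t -> is_derive t 1 Z (A *m Z t)) /\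
  Z t @[t --> 0^'+] --> Z 0.

Definition gathering (R : realType) N (A : 'M[R]_(N + N)) : Prop :=
  (forall Z : R -> 'cV[R]_(N + N), is_solution A Z ->
     exists xs ys : R, forall i : 'I_N,
       xpos (Z t) i @[t --> +oo] --> xs /\ ypos (Z t) i @[t --> +oo] --> ys) /\
  (forall Z : 'cV[R]_(N + N),
     (forall i j : 'I_N, xpos Z i = xpos Z j /\ ypos Z i = ypos Z j) ->
     A *m Z = 0).

(* Euler's form of exp(2 pi i / N) *)
Definition omega (R : realType) (N : nat) : R[i] :=
  (cos (2 * pi / N%:R) +i* sin (2 * pi / N%:R))%C.

Definition eigvec (R : realType) (N j : nat) : 'cV[R[i]]_N :=
  \col_i (omega R N ^+ (j * i)).

Definition eigval (R : realType) N (w : 'I_N -> R) (j : nat) : R[i] :=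
  \sum_(i < N) (w i)%:C%C * omega R N ^+ (i * j).

Definition reV (R : realType) (N j : nat) : 'cV[R]_N :=
  map_mx (@complex.Re R) (eigvec R N j).

Definition imV (R : realType) (N j : nat) : 'cV[R]_N :=
  map_mx (@complex.Im R) (eigvec R N j).

Definition V0 (R : realType) (N : nat) : {vspace 'cV[R]_(N + N)} :=
  <<[:: col_mx (const_mx 1) 0; col_mx 0 (const_mx 1)]>>%VS.

Lemma V0P (R : realType) (N : nat) (Z : 'cV[R]_(N + N)) :
  reflect (exists xs ys : R, Z = col_mx (const_mx xs) (const_mx ys))
    (Z \in V0 R N).
Proof.
have E (a b : R) : col_mx (const_mx a) (const_mx b) =
    a *: col_mx (const_mx 1) 0 + b *: col_mx 0 (const_mx 1) :> 'cV[R]_(N + N).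
  rewrite !scale_col_mx !scaler0 add_col_mx addr0 add0r.
  by congr col_mx; apply/matrixP => i j; rewrite !mxE mulr1.
rewrite /V0 span_cons span_seq1.
apply: (iffP memv_addP) => [[_ /vlineP[a ->] [_ /vlineP[b ->] ->]]|[a [b ->]]].
  by exists a, b; rewrite E.
exists (a *: col_mx (const_mx 1) 0); first by rewrite memvZ ?memv_line.
by exists (b *: col_mx 0 (const_mx 1)); rewrite ?memvZ ?memv_line.
Qed.

Definition Vj (R : realType) (N j : nat) : {vspace 'cV[R]_(N + N)} :=
  <<[:: col_mx (reV R N j) (- imV R N j);
        col_mx (imV R N j) (reV R N j);
        col_mx (- imV R N j) (reV R N j);
        col_mx (reV R N j) (imV R N j)]>>%VS.

(* `|_| is the sup norm of 'cV[R]_n; as R^n is finite-dimensional, replacing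
   it by another norm only changes the constants c and C. *)
Definition stable_invariant (R : realType) n (A : 'M[R]_n)
    (U : {vspace 'cV[R]_n}) (r : R) : Prop :=
  [/\ r < 1,
      (forall Z : R -> 'cV[R]_n, is_solution A Z -> Z 0 \in U ->
         (forall t : R, 0 <= t -> Z t \in U) /\ Z t @[t --> +oo] --> (0 : 'cV[R]_n)) &
      exists c C : R, [/\ 0 < c, c <= C &
        forall Z : R -> 'cV[R]_n, is_solution A Z -> Z 0 \in U ->
        forall t : R, 0 <= t ->
          c * expR ((-1 + r) * t) * `|Z 0| <= `|Z t| <=
          C * expR ((-1 + r) * t) * `|Z 0|]].

(* Main.v *)
(** The real and imaginary parts of the Fourier vector [v_j] span a subspace
    on which [W] acts as the complex number [lambda_j] and [W^T] as its
    conjugate, so [V_j] is invariant and [A + A^T = 2 (-1 + Re lambda_j)] there,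
    where [A = -1 + W] is the matrix of the system. A solution starting in an
    invariant subspace stays in it, and [|Z|^2] has derivative
    [Z^T (A + A^T) Z]: on [V_j] the Euclidean norm is therefore exactly
    [e^((-1 + Re lambda_j) t) |Z(0)|]. Gathering forces [sum w = 1], hence
    [Re lambda_j <= 1]; equality would give [lambda_j = 1] and thus the
    stationary non-gathered solution [(Re v_j, 0)]. The inverse Fourier
    transform together with [v_(N-j) = conj v_j] shows that the subspaces span,
    and since the obvious upper bounds of their dimensions add up to [2N], these
    bounds are attained and the sum is direct. *)

Require Import Defs.
From mathcomp Require Import all_boot all_order all_algebra.
From mathcomp Require Import complex ring lra zify.
From mathcomp Require Import all_classical all_reals all_analysis.

Import Order.TTheory GRing.Theory Num.Theory.
Import numFieldNormedType.Exports.
Local Open Scope ring_scope.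

Set Implicit Arguments.
Unset Strict Implicit.

(** * Scalar linear differential inequalities on the half-line *)

(** The product of [h] with [expR (- K * t)] has nonpositive derivative, so the mean value theorem
    bounds it by its value at [0]. One-sided continuity at [0] matches [is_solution], which says
    nothing about negative times. *)
Lemma gronwall (R : realType) (K : R) (h dh : R -> R) :
  (forall t : R, 0 < t -> is_derive t 1 h (dh t)) ->
  (forall t : R, 0 < t -> dh t <= K * h t) ->
  (h t @[t --> 0^'+] --> h 0)%classic ->
  forall t : R, 0 <= t -> h t <= expR (K * t) * h 0.
Proof.
move=> hder hle h0 t t0.
pose g (s : R) := expR (- K * s) * h s.
pose dg (s : R) := expR (- K * s) * (dh s - K * h s).
have gder (s : R) : 0 < s -> is_derive s 1 g (dg s).
  move=> s0; have := hder s s0 => hs.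
  have e1 : is_derive s 1 (fun u : R => - K * u) (- K).
    have := @is_deriveZ R R R id (- K) s 1 1 (is_derive_id s 1).
    by rewrite /GRing.scale /= mulr1.
  have e2 := @is_derive1_comp R expR (fun u : R => - K * u) s _ _ (is_derive_expR _) e1.
  have := @is_deriveM R R (expR \o (fun u : R => - K * u)) h s 1 _ _ e2 hs.
  by move=> e3; apply: is_derive_eq; rewrite /dg /GRing.scale /=; ring.
suff : g t <= g 0.
  rewrite /g mulr0 expR0 mul1r mulNr expRN => H.
  by rewrite -ler_pdivrMl ?expR_gt0.
have gcont (s : R) : 0 < s -> {for s, continuous g}.
  move=> s0; apply/differentiable_continuous/derivable1_diffP.
  by have [] := gder s s0.
have gr0 : (g u @[u --> 0^'+] --> g 0)%classic.
  apply: cvgM => //; apply: cvg_at_right_filter.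
  apply: (@continuous_comp _ _ _ (fun u : R => - K * u) expR).
    exact: mulrl_continuous.
  exact: continuous_expR.
have [t_le0|t_gt0] := leP t 0; first by have -> : t = 0 by lra.
have [x||c] := @MVT R g dg 0 t t_gt0.
- by rewrite in_itv /= => /andP[x0 _]; exact: gder.
- apply/continuous_within_itvP => //; split => //.
    by move=> x; rewrite in_itv /= => /andP[x0 _]; exact: gcont.
  exact/cvg_at_left_filter/gcont.
rewrite in_itv /= subr0 => /andP[c0 _] e.
rewrite -subr_le0 e mulr_le0_ge0 ?(ltW t_gt0)// /dg.
by rewrite mulr_ge0_le0 ?expR_ge0// subr_le0 hle.
Qed.

Lemma gronwall_eq (R : realType) (K : R) (h : R -> R) :
  (forall t : R, 0 < t -> is_derive t 1 h (K * h t)) ->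
  (h t @[t --> 0^'+] --> h 0)%classic ->
  forall t : R, 0 <= t -> h t = expR (K * t) * h 0.
Proof.
move=> hder h0 t t0; apply/eqP; rewrite eq_le.
apply/andP; split; first exact: (gronwall hder).
rewrite -lerN2 -mulrN.
apply: (gronwall (h := - h) (dh := fun s : R => - (K * h s))) => //.
- by move=> s s0; have := hder s s0 => ?; exact: is_deriveN.
- by move=> s s0; rewrite -mulrN.
- exact: cvgN.
Qed.

(** * Squared Euclidean norm and sup norm *)

(** Unlike the sup norm, it is differentiable along solutions. *)
Definition sqn (R : realType) n (Z : 'cV[R]_n) : R := \sum_i Z i 0 ^+ 2.

Lemma sqn_ge0 (R : realType) n (Z : 'cV[R]_n) : 0 <= sqn Z.
Proof. by apply: sumr_ge0 => i _; rewrite sqr_ge0. Qed.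

Lemma sq_le_sqn (R : realType) n (Z : 'cV[R]_n) i : Z i 0 ^+ 2 <= sqn Z.
Proof.
by rewrite /sqn (bigD1 i) //= lerDl sumr_ge0 // => j _; rewrite sqr_ge0.
Qed.

Lemma coord_le_norm (R : realType) {m n} (Z : 'M[R]_(m, n)) i j : `|Z i j| <= `|Z|.
Proof.
rewrite [leRHS]/Num.Def.normr /= mx_normrE.
exact: (le_bigmax _ (fun ij : 'I_m * 'I_n => `|Z ij.1 ij.2|) (i, j)).
Qed.

Lemma norm_le_sqn (R : realType) n (Z : 'cV[R]_n) : `|Z| ^+ 2 <= sqn Z.
Proof.
have sq i : `|Z i 0| <= Num.sqrt (sqn Z).
  rewrite -(ler_sqr (normr_ge0 _)) ?nnegrE ?sqrtr_ge0 ?qualifE //=.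
  rewrite sqr_sqrtr ?sqn_ge0// real_normK ?num_real //.
  exact: sq_le_sqn.
have : `|Z| <= Num.sqrt (sqn Z).
  rewrite [leLHS]/Num.Def.normr /= mx_normrE.
  by apply: bigmax_le; rewrite ?sqrtr_ge0// => -[i j] _ /=; rewrite ord1.
move=> H; rewrite -[leRHS](sqr_sqrtr (sqn_ge0 _)).
by rewrite ler_sqr ?nnegrE ?sqrtr_ge0.
Qed.

(** The crude factor [n.+1] is at least 1 even for [n = 0], so it and its inverse can serve as the
    constants [C] and [c] of stability. *)
Lemma sqn_le_norm (R : realType) n (Z : 'cV[R]_n) :
  sqn Z <= (n.+1%:R * `|Z|) ^+ 2.
Proof.
apply: (@le_trans _ _ (\sum_(i < n) `|Z| ^+ 2)).
  apply: ler_sum => i _.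
  rewrite -[leLHS]real_normK ?num_real// ler_sqr ?nnegrE //.
  exact: coord_le_norm.
rewrite sumr_const card_ord exprMn -[leLHS]mulr_natl ler_wpM2r ?sqr_ge0 //.
by rewrite -natrX ler_nat (leq_trans (leqnSn n)) // leq_pmulr.
Qed.

(** * Solutions of linear systems: uniqueness and invariant subspaces *)

Lemma sol_coord (R : realType) n (A : 'M[R]_n) Z : is_solution A Z ->
  forall i, (forall t : R, 0 < t ->
      is_derive t 1 (fun s : R => Z s i 0) ((A *m Z t) i 0))
    /\ (Z t i 0 @[t --> 0^'+] --> Z 0 i 0)%classic.
Proof.
case=> hd hc i; split.
  move=> t t0; have [d e] := hd t t0.
  apply: DeriveDef; first exact: (derivable_mxP _ _ _).1 d i 0.
  by rewrite -e derive_mx // mxE.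
exact: (@cvg_comp _ _ _ Z (fun M : 'cV[R]_n => M i 0) _ _ _ hc
  (@coord_continuous _ _ _ i 0 (Z 0))).
Qed.

Lemma sol_sqn (R : realType) n (A : 'M[R]_n) Z : is_solution A Z ->
  (forall t : R, 0 < t -> is_derive t 1 (fun s : R => sqn (Z s))
                        (2 * \sum_i Z t i 0 * (A *m Z t) i 0))
    /\ (sqn (Z t) @[t --> 0^'+] --> sqn (Z 0))%classic.
Proof.
move=> /sol_coord hZ.
have -> : (fun s : R => sqn (Z s)) = \sum_(i < n) (fun s : R => Z s i 0 * Z s i 0).
  by apply/funext => s; rewrite fct_sumE.
split; last first.
  rewrite fct_sumE /sqn; apply: cvg_big => [|i _]; first exact: add_continuous.
  by apply: cvgM; apply: (hZ i).2.
move=> t t0; rewrite mulr_sumr.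
apply: (@is_derive_sum R R R n (fun i (s : R) => Z s i 0 * Z s i 0)) => i.
have d := (hZ i).1 t t0.
by apply: (is_derive_eq (is_deriveM d d)); rewrite /GRing.scale /=; ring.
Qed.

(** As [Q] is constant, [Q Z] has derivative [Q A Z = B Q Z]. With [Q] a projection along a
    subspace, this reduces invariance of the subspace to uniqueness of the zero solution. *)
Lemma sol_sub (R : realType) n (A B Q : 'M[R]_n) Z :
  Q *m A = B *m Q -> is_solution A Z -> is_solution B (fun t => Q *m Z t).
Proof.
move=> QA hZ; have hc := sol_coord hZ; split.
  move=> t t0.
  have dij i j :
      is_derive t 1 (fun s : R => (Q *m Z s) i j) ((Q *m (A *m Z t)) i j).
    have -> : (fun s : R => (Q *m Z s) i j) =
        \sum_(l < n) (fun s : R => Q i l * Z s l j).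
      by apply/funext => s; rewrite fct_sumE mxE.
    rewrite mxE; apply: (@is_derive_sum R R R n (fun l (s : R) => Q i l * Z s l j)) => l.
    by rewrite ord1; have d := (hc l).1 t t0; exact: is_deriveZ.
  have dQ : derivable (fun s : R => Q *m Z s) t 1.
    by apply/derivable_mxP => i j; have [] := dij i j.
  apply: DeriveDef => //; rewrite derive_mx // mulmxA -QA -mulmxA.
  by apply/matrixP => i j; rewrite mxE; have [] := dij i j.
(* A ball of matrices is an entrywise condition on finitely many entries. *)
apply/cvg_ballP => e e0; near=> t.
split => // i j; move: i j; near: t.
apply: filter_forall => i; apply: filter_forall => j.
have : ((Q *m Z t) i j @[t --> 0^'+] --> (Q *m Z 0) i j)%classic.
  under eq_cvg do rewrite mxE.
  rewrite mxE; apply: cvg_big => [|l _]; first exact: add_continuous.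
  apply: cvgM; first exact: cvg_cst.
  by rewrite ord1; exact: (hc l).2.
by move/cvg_ballP; exact.
Unshelve. all: by end_near. Qed.

Lemma sol_unique0 (R : realType) n (B : 'M[R]_n) Z :
  is_solution B Z -> Z 0 = 0 -> forall t : R, 0 <= t -> Z t = 0.
Proof.
move=> hZ Z0 t t0.
have [hd hc] := sol_sqn hZ.
(* A product of two coordinates of [Z] is at most [sqn Z] in absolute value, so the derivative of
   [sqn Z] is at most [K * sqn Z]. *)
pose K := 2 * \sum_i \sum_j `|B i j|.
have hle (s : R) : 0 < s -> 2 * \sum_i Z s i 0 * (B *m Z s) i 0 <= K * sqn (Z s).
  move=> s0; rewrite /K -mulrA ler_pM2l // mulr_suml; apply: ler_sum => i _.
  rewrite mxE mulr_sumr mulr_suml; apply: ler_sum => j _.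
  rewrite mulrCA (le_trans (ler_norm _))// normrM ler_wpM2l //.
  rewrite ler_norml; have := sq_le_sqn (Z s) i; have := sq_le_sqn (Z s) j.
  by move: (sqn (Z s)) => S h1 h2; apply/andP; split; nra.
have := gronwall hd hle hc t0.
have -> : sqn (Z 0) = 0 by rewrite Z0 /sqn big1 // => i _; rewrite mxE expr0n.
rewrite mulr0 => h; apply/matrixP => i j; rewrite ord1 mxE.
have : Z t i 0 ^+ 2 <= 0.
  exact: le_trans (sq_le_sqn _ _) h.
by move=> h1; apply/eqP; rewrite -sqrf_eq0 eq_le h1 sqr_ge0.
Qed.

Lemma sol_invariant (R : realType) n (A : 'M[R]_n) (U : {vspace 'cV[R]_n}) Z :
  (forall x, x \in U -> A *m x \in U) ->
  is_solution A Z -> Z 0 \in U -> forall t : R, 0 <= t -> Z t \in U.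
Proof.
move=> AU hZ Z0 t t0.
(* Q projects along U, so Q A = (Q A) Q and Q Z solves a linear system with
   initial value 0. *)
pose q := (\1 - projv U)%VF.
have qE x : q x = x - projv U x by rewrite add_lfunE opp_lfunE id_lfunE.
pose Q : 'M[R]_n := \matrix_(i, j) q (delta_mx j 0) i 0.
have QE x : Q *m x = q x.
  rewrite [x in RHS]matrix_sum_delta linear_sum; apply/matrixP => i j.
  rewrite mxE ord1 summxE; apply: eq_bigr => l _.
  by rewrite big_ord1 linearZ !mxE mulrC.
have QU x : (x \in U) = (Q *m x == 0).
  rewrite QE qE subr_eq0; apply/idP/eqP => [/projv_id->//|->]; exact: memv_proj.
(* Column by column: [1 - Q] is the projection onto [U], which [A] preserves, and [Q] vanishes on
   [U]. *)
have QA : Q *m A = (Q *m A) *m Q.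
  apply/eqP; rewrite -subr_eq0 -[X in X - _]mulmx1 -mulmxBr; apply/eqP.
  apply/matrixP => i j; rewrite mxE [RHS]mxE.
  have := AU _ (memv_proj U (delta_mx j 0)).
  rewrite QU mulmxA => /eqP/matrixP/(_ i 0); rewrite mxE [in RHS]mxE => {2}<-.
  have -> : projv U (delta_mx j 0) = (1%:M - Q) *m delta_mx j 0.
    by rewrite mulmxBl mul1mx QE qE opprB addrC subrK.
  apply: eq_bigr => l _; congr (_ * _).
  by rewrite -colE !mxE.
rewrite QU; apply/eqP.
apply: (sol_unique0 (sol_sub QA hZ)) => //.
by apply/eqP; rewrite -QU.
Qed.

(** * Stability when the symmetric part is scalar *)

Lemma stable_invariant_scalar_sym (R : realType) n (A : 'M[R]_n)
    (U : {vspace 'cV[R]_n}) (r : R) :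
  r < 1 ->
  (forall x, x \in U -> A *m x \in U) ->
  (forall x, x \in U -> (A + A^T) *m x = (2 * (-1 + r)) *: x) ->
  stable_invariant A U r.
Proof.
move=> r1 AU AE.
have dotE x : x \in U -> 2 * (\sum_i x i 0 * (A *m x) i 0) = 2 * (-1 + r) * sqn x.
  move=> xU.
  have -> : 2 * (-1 + r) * sqn x = \sum_i x i 0 * ((A + A^T) *m x) i 0.
    by rewrite AE // mulr_sumr; apply: eq_bigr => i _; rewrite mxE; ring.
  under [RHS]eq_bigr do rewrite mulmxDl mxE mulrDr.
  rewrite big_split /= mulr_natl mulr2n; congr (_ + _).
  under eq_bigr do rewrite mxE mulr_sumr.
  under [RHS]eq_bigr do rewrite mxE mulr_sumr.
  rewrite exchange_big; apply: eq_bigr => i _; apply: eq_bigr => j _.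
  by rewrite mxE; ring.
(* Since [Z] stays in [U], [sqn Z] solves a scalar linear equation with rate [2 * (-1 + r)] and is
   known exactly. *)
have sq Z : is_solution A Z -> Z 0 \in U -> forall t : R, 0 <= t ->
    sqn (Z t) = expR ((-1 + r) * t) ^+ 2 * sqn (Z 0).
  move=> hZ Z0 t t0; have [hd hc] := sol_sqn hZ.
  rewrite -expRM_natl [2 * _]mulrA.
  apply: (gronwall_eq (h := fun s => sqn (Z s))) => // s s0.
  have Zs : Z s \in U by apply: (sol_invariant AU hZ Z0); exact: ltW.
  rewrite -(dotE _ Zs); exact: hd.
(* Only the passage between Euclidean and sup norm loses a factor, namely [d] in each direction. *)
pose d : R := n.+1%:R.
have d1 : 1 <= d by rewrite /d ler1n.
have d0 : 0 < d by lra.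
have bnd Z : is_solution A Z -> Z 0 \in U -> forall t : R, 0 <= t ->
    d^-1 * expR ((-1 + r) * t) * `|Z 0| <= `|Z t| <=
    d * expR ((-1 + r) * t) * `|Z 0|.
  move=> hZ Z0 t t0; have e := sq Z hZ Z0 t t0.
  have e0 := expR_ge0 ((-1 + r) * t).
  rewrite -mulrA ler_pdivrMl //; apply/andP; split.
    rewrite -ler_sqr ?nnegrE ?mulr_ge0 // ?(ltW d0) //.
    apply: le_trans; last exact: sqn_le_norm.
    rewrite e exprMn ler_wpM2l ?sqr_ge0 //.
    exact: norm_le_sqn.
  rewrite -ler_sqr ?nnegrE ?mulr_ge0 // ?(ltW d0) //.
  apply: (le_trans (norm_le_sqn _)); rewrite e.
  have -> : d * expR ((-1 + r) * t) * `|Z 0| =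
      expR ((-1 + r) * t) * (d * `|Z 0|) by ring.
  by rewrite exprMn ler_wpM2l ?sqr_ge0 // sqn_le_norm.
split => //.
- move=> Z hZ Z0; split; first exact: sol_invariant hZ Z0.
  apply: norm_cvg0.
  apply: (@squeeze_cvgr _ _ _ _ (fun=> 0)
    (fun t : R => d * expR ((-1 + r) * t) * `|Z 0|)).
  + near=> t; rewrite normr_ge0 /=.
    by have /(_ _)/andP[|_ ->//] := bnd Z hZ Z0 t.
  + exact: cvg_cst.
  + rewrite -[X in (_ --> X)%classic](mul0r `|Z 0|) -(mulr0 d).
    apply: cvgMl; apply: cvgMr.
    (* Written as [expR (- u)] with [u = (1 - r) * t], which tends to infinity because [r < 1]. *)
    have -> : (fun t => expR ((-1 + r) * t)) =
        (fun u => expR (- u)) \o (fun t => (1 - r) * t).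
      by apply/funext => t /=; congr expR; ring.
    apply: cvg_comp (@cvgr_expR R).
    by apply: gt0_cvgMry => //; lra.
- exists d^-1, d; split => //; first by rewrite invr_gt0.
  by rewrite (le_trans _ d1) // invf_le1.
Unshelve. all: by end_near. Qed.

(** * Powers of the root of unity *)

Lemma omegaX (R : realType) N n :
  omega R N ^+ n = (cos (n%:R * (2 * pi / N%:R)) +i* sin (n%:R * (2 * pi / N%:R)))%C.
Proof.
elim: n => [|n IH]; first by rewrite expr0 mul0r cos0 sin0.
rewrite exprS IH /omega; move: (2 * pi / N%:R) => x.
have -> : n.+1%:R * x = n%:R * x + x by rewrite -natr1; ring.
rewrite cosD sinD.
by simpc; congr (_ +i* _)%C; ring.
Qed.

Lemma omega_norm (R : realType) N n :
  complex.Re (omega R N ^+ n) ^+ 2 + complex.Im (omega R N ^+ n) ^+ 2 = 1.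
Proof. by rewrite omegaX /= cos2Dsin2. Qed.

Lemma Re_omega_le1 (R : realType) N n : complex.Re (omega R N ^+ n) <= 1.
Proof. by have := omega_norm R N n; nra. Qed.

Lemma Re_omega_eq1 (R : realType) N n :
  complex.Re (omega R N ^+ n) = 1 -> omega R N ^+ n = 1.
Proof.
have := omega_norm R N n; case: (omega R N ^+ n) => a b /= h a1.
have b0 : b ^+ 2 = 0 by move: h; rewrite a1; lra.
by move/eqP: b0; rewrite sqrf_eq0 => /eqP ->; rewrite a1.
Qed.

(** If a power with exponent [n], [0 < n < N], were 1, then the cosine of twice [pi * n / N] would
    be 1, forcing the sine of [pi * n / N] to vanish; but this angle lies strictly between 0 and
    [pi]. *)
Lemma omega_prim (R : realType) N : (0 < N)%N -> N.-primitive_root (omega R N).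
Proof.
move=> N0; have N0' : (N%:R : R) != 0 by rewrite pnatr_eq0 -lt0n.
have oN : omega R N ^+ N = 1.
  rewrite omegaX; have -> : N%:R * (2 * pi / N%:R) = pi *+ 2 :> R.
    by rewrite mulrCA divff // mulr1 mulr_natl.
  by rewrite cos2pi sin2pi.
apply/andP; split=> //; apply/forallP => i; apply/eqP.
rewrite unity_rootE; have [->|iN] := eqVneq i.+1 N; first by rewrite oN eqxx.
apply/negbTE/eqP => /(congr1 (@complex.Re R)); rewrite omegaX /=.
have {iN} iN : (i.+1 < N)%N by rewrite ltn_neqAle iN ltn_ord.
have -> : i.+1%:R * (2 * pi / N%:R) = (pi * (i.+1%:R / N%:R)) *+ 2 :> R.
  by rewrite -mulr_natl; ring.
rewrite cos_mulr2n => h.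
have : 0 < sin (pi * (i.+1%:R / N%:R) : R).
  apply: sin_gt0_pi; rewrite pmulr_rgt0 ?pi_gt0 // divr_gt0 ?ltr0n //=.
  by rewrite gtr_pMr ?pi_gt0 // ltr_pdivrMr ?ltr0n // mul1r ltr_nat.
have := cos2Dsin2 (pi * (i.+1%:R / N%:R) : R).
move: h; move: (cos _) (sin _) => c s h1 h2 h3.
have : 0 < s ^+ 2 by rewrite exprn_gt0.
by rewrite -mulr_natr in h1; lra.
Qed.

Lemma omegaXN (R : realType) N : (0 < N)%N -> omega R N ^+ N = 1.
Proof. by move=> /(omega_prim R)/prim_expr_order. Qed.

Lemma omega_mod (R : realType) N n : (0 < N)%N ->
  omega R N ^+ (n %% N) = omega R N ^+ n.
Proof. by move=> /(omega_prim R)/prim_expr_mod. Qed.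

(** The two powers have product 1, and on the unit circle inverse and conjugate agree. *)
Lemma omega_conj (R : realType) N n m : (0 < N)%N -> (N %| n + m)%N ->
  omega R N ^+ n = (omega R N ^+ m)^*%C.
Proof.
move=> N0 /eqP nm.
have : omega R N ^+ n * omega R N ^+ m = 1.
  by rewrite -exprD -omega_mod // nm expr0.
have := omega_norm R N m.
case: (omega R N ^+ m) => a b; case: (omega R N ^+ n) => c d /=.
move=> h; simpc => -[h1 h2].
(* [h1] and [h2] are linear equations in [c] and [d] whose determinant [a ^+ 2 + b ^+ 2] is 1. *)
congr (_ +i* _)%C.
  have -> : c = c * (a ^+ 2 + b ^+ 2) by rewrite h mulr1.
  have -> : c * (a ^+ 2 + b ^+ 2) = a * (c * a - d * b) + b * (c * b + d * a) by ring.
  by rewrite h1 h2; ring.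
have -> : d = d * (a ^+ 2 + b ^+ 2) by rewrite h mulr1.
have -> : d * (a ^+ 2 + b ^+ 2) = a * (c * b + d * a) - b * (c * a - d * b) by ring.
by rewrite h1 h2; ring.
Qed.

(** * Eigenvectors of a circulant matrix and of its transpose *)

Lemma subord_modK N (i m : 'I_N) : (subord_mod i m + i)%N = m %[mod N].
Proof.
by rewrite /= modnDml -addnA subnK ?modnDr // ltnW.
Qed.

Lemma subord_mod_inj N (i : 'I_N) : injective (subord_mod i).
Proof.
move=> m m' e; apply: val_inj => /=.
by rewrite -(modn_small (ltn_ord m)) -(modn_small (ltn_ord m')) -!(subord_modK i) e.
Qed.

Lemma subord_mod_injl N (i : 'I_N) : injective (fun m => subord_mod m i).
Proof.
move=> m m' e; apply: val_inj => /=.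
rewrite -(modn_small (ltn_ord m)) -(modn_small (ltn_ord m')); apply/eqP.
rewrite -(eqn_modDl (subord_mod m i)) {2}e.
by rewrite !subord_modK.
Qed.

Arguments subord_mod_inj {N} i.
Arguments subord_mod_injl {N} i.

(** Reindexing the sum [lambda_j] by [m - i] modulo [N] matches it with row [i], since exponents of
    [omega] only matter modulo [N]. *)
Lemma eigvecP (R : realType) N (w : 'I_N -> R) j :
  map_mx (real_complex R) (circ w) *m eigvec R N j = eigval w j *: eigvec R N j.
Proof.
apply/matrixP => i m0; rewrite ord1 !mxE {m0}.
have N0 : (0 < N)%N by apply: leq_ltn_trans (ltn_ord i).
rewrite /eigval mulr_suml [RHS](reindex_inj (subord_mod_inj i)) /=.
apply: eq_bigr => m _; rewrite !mxE -mulrA; congr (_ * _).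
rewrite [(_ * j)%N]mulnC -exprD -mulnDr !exprM -[LHS](expr_mod _ (_ : _ ^+ N = 1)).
  by rewrite -(subord_modK i) expr_mod // -exprM mulnC exprM omegaXN // expr1n.
by rewrite -exprM mulnC exprM omegaXN // expr1n.
Qed.

(** Transposition reverses the shift: weight [s] now meets the exponent [- s * j], and conjugating
    [lambda_j] does the same because the weights are real. *)
Lemma eigvec_trP (R : realType) N (w : 'I_N -> R) j :
  map_mx (real_complex R) (circ w)^T *m eigvec R N j =
  (eigval w j)^*%C *: eigvec R N j.
Proof.
apply/matrixP => i m0; rewrite ord1 !mxE {m0}.
have N0 : (0 < N)%N by apply: leq_ltn_trans (ltn_ord i).
rewrite /eigval rmorph_sum mulr_suml [RHS](reindex_inj (subord_mod_injl i)) /=.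
apply: eq_bigr => m _; rewrite !mxE.
have cM (a : R) (z : R[i]) : (a%:C * z)^*%C = a%:C%C * z^*%C.
  by rewrite rmorphM; congr (_ * _); exact: conjc_real.
rewrite [(_ * _)^*%C]cM -mulrA; congr (_ * _).
set s := subord_mod m i.
(* [N - s] stands for the exponent [- s] in natural numbers. *)
rewrite -(omega_conj R (n := (N - s) * j)) //; last first.
  by rewrite -mulnDl subnK ?dvdn_mulr // ltnW.
rewrite -exprD [((N - s) * j)%N]mulnC -mulnDr !exprM.
have zN : (omega R N ^+ j) ^+ N = 1 by rewrite -exprM mulnC exprM omegaXN // expr1n.
rewrite exprD -[in RHS](expr_mod i zN) -(subord_modK m) expr_mod // -exprD addnA.
by rewrite subnK ?exprD ?zN ?mul1r // ltnW.
Qed.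

Lemma map_Re_mul (R : realType) m n p (M : 'M[R]_(m, n)) (v : 'M[R[i]]_(n, p)) :
  map_mx (@complex.Re R) (map_mx (real_complex R) M *m v) =
  M *m map_mx (@complex.Re R) v.
Proof.
apply/matrixP => i j; rewrite !mxE.
rewrite (big_morph (@complex.Re R) (id1 := 0) (op1 := +%R)) //; last by case=> ? ? [].
by apply: eq_bigr => l _; rewrite !mxE; case: (v l j) => a b /=; rewrite mul0r subr0.
Qed.

Lemma map_Im_mul (R : realType) m n p (M : 'M[R]_(m, n)) (v : 'M[R[i]]_(n, p)) :
  map_mx (@complex.Im R) (map_mx (real_complex R) M *m v) =
  M *m map_mx (@complex.Im R) v.
Proof.
apply/matrixP => i j; rewrite !mxE.
rewrite (big_morph (@complex.Im R) (id1 := 0) (op1 := +%R)) //; last by case=> ? ? [].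
by apply: eq_bigr => l _; rewrite !mxE; case: (v l j) => a b /=; rewrite mul0r addr0.
Qed.

Lemma eig_reim (R : realType) N j (M : 'M[R]_N) (l : R[i]) :
  map_mx (real_complex R) M *m eigvec R N j = l *: eigvec R N j ->
  M *m reV R N j = complex.Re l *: reV R N j - complex.Im l *: imV R N j /\
  M *m imV R N j = complex.Re l *: imV R N j + complex.Im l *: reV R N j.
Proof.
move=> e; split; rewrite -?map_Re_mul -?map_Im_mul e; apply/matrixP => i k; rewrite !mxE;
  by case: l {e} => a b; case: (omega R N ^+ _) => c d.
Qed.

(** * Coordinates on the subspaces [Vj] and the action of the system *)

(** These coordinates decouple the generators of [Vj]: [X] and [Y] are independent combinations of
    the real and imaginary parts of [v_j], as suits a block-diagonal matrix. *)
Definition comb (R : realType) N j (a b c d : R) : 'cV[R]_(N + N) :=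
  col_mx (a *: reV R N j + b *: imV R N j) (c *: reV R N j + d *: imV R N j).

Lemma comb_lin (R : realType) N j (x a b c d a' b' c' d' : R) :
  x *: comb N j a b c d + comb N j a' b' c' d' =
  comb N j (x * a + a') (x * b + b') (x * c + c') (x * d + d').
Proof.
rewrite /comb scale_col_mx add_col_mx !scalerDr !scalerDl !scalerA.
by congr col_mx; rewrite addrACA.
Qed.

Lemma VjP (R : realType) N j (Z : 'cV[R]_(N + N)) :
  reflect (exists a b c d : R, Z = comb N j a b c d) (Z \in Vj R N j).
Proof.
have g a b c d : comb N j a b c d =
    ((a + d) / 2) *: col_mx (reV R N j) (imV R N j)
    + ((a - d) / 2) *: col_mx (reV R N j) (- imV R N j)
    + ((b + c) / 2) *: col_mx (imV R N j) (reV R N j)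
    + ((c - b) / 2) *: col_mx (- imV R N j) (reV R N j).
  rewrite /comb !scale_col_mx !add_col_mx !scalerN; congr col_mx;
  by apply/matrixP => k l; rewrite !mxE; field.
apply: (iffP idP) => [|[a [b [c [d ->]]]]].
  rewrite /Vj !span_cons span_nil addv0.
  move=> /memv_addP[_ /vlineP[a ->] [_ /memv_addP[_ /vlineP[b ->]
    [_ /memv_addP[_ /vlineP[c ->] [_ /vlineP[d ->] ->]] ->]] ->]].
  exists (a + d), (b - c), (b + c), (d - a); rewrite /comb.
  rewrite !scale_col_mx !add_col_mx !scalerN; congr col_mx;
  by apply/matrixP => k l; rewrite !mxE; ring.
by rewrite g !memvD // memvZ // memv_span // !inE eqxx ?orbT.
Qed.

Lemma cld_col (R : realType) N (M : 'M[R]_N) (X Y : 'cV[R]_N) :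
  (- 1%:M + block_mx M 0 0 M) *m col_mx X Y = col_mx (M *m X - X) (M *m Y - Y).
Proof.
rewrite mulmxDl mulNmx mul1mx mul_block_col !mul0mx addr0 add0r opp_col_mx add_col_mx.
by rewrite ![- _ + _]addrC.
Qed.

(* M is arbitrary because this is used for both W and W^T. *)
Lemma cld_comb (R : realType) N (M : 'M[R]_N) (l : R[i]) (j : nat) (a b c d : R) :
  map_mx (real_complex R) M *m eigvec R N j = l *: eigvec R N j ->
  (- 1%:M + block_mx M 0 0 M) *m comb N j a b c d =
  let p := complex.Re l - 1 in let q := complex.Im l in
  comb N j (p * a + q * b) (p * b - q * a) (p * c + q * d) (p * d - q * c).
Proof.
move=> /eig_reim[e1 e2]; rewrite /comb cld_col !mulmxDr -!scalemxAr e1 e2.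
by congr col_mx; apply/matrixP => i k; rewrite !mxE /=; ring.
Qed.

Lemma Vj_eig (R : realType) N (w : 'I_N -> R) j x : x \in Vj R N j ->
  cld_matrix w *m x \in Vj R N j /\
  (cld_matrix w + (cld_matrix w)^T) *m x =
    (2 * (- 1 + complex.Re (eigval w j))) *: x.
Proof.
move=> /VjP[a [b [c [d ->]]]].
have e1 := cld_comb a b c d (eigvecP w j).
have e2 := cld_comb a b c d (eigvec_trP w j).
split; first by rewrite /cld_matrix e1; apply/VjP; do 4!eexists.
have -> : (cld_matrix w)^T = - 1%:M + block_mx (circ w)^T 0 0 (circ w)^T.
  by rewrite /cld_matrix linearD linearN /= trmx1 tr_block_mx !trmx0.
rewrite mulmxDl e2 /cld_matrix e1 /=; move: e1 e2 => _ _.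
case: (eigval w j) => p q /=.
(* Both sides are shaped for [comb_lin]; the terms in [q] then cancel, having opposite signs for [W]
   and its transpose. *)
rewrite -[X in X + _]scale1r -[RHS]addr0.
have -> : 0 = comb N j 0 0 0 0 :> 'cV[R]_(N + N).
  by rewrite /comb !scale0r !addr0 col_mx0.
rewrite !comb_lin; congr comb; ring.
Qed.

(** * Gathering forces convergence rates below 1 *)

(** Placing all robots at [(1, 0)] is an equilibrium; its first coordinate gives the sum. *)
Lemma rowsum1 (R : realType) N (w : 'I_N -> R) : (0 < N)%N ->
  gathering (cld_matrix w) -> \sum_i w i = 1.
Proof.
move=> N0 [_ hg].
have := hg (col_mx (const_mx 1) 0) _; rewrite /cld_matrix cld_col => /(_ _)/eqP.
rewrite col_mx_eq0 => /(_ _)/andP[|/eqP/matrixP/(_ (Ordinal N0) 0) + _].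
  by move=> i j; rewrite /xpos /ypos col_mxKu col_mxKd !mxE.
rewrite !mxE => /eqP; rewrite subr_eq0 => /eqP <-.
rewrite (reindex_inj (subord_mod_inj (Ordinal N0))).
by apply: eq_bigr => i _; rewrite !mxE mulr1.
Qed.

Lemma Re_eigval (R : realType) N (w : 'I_N -> R) j :
  complex.Re (eigval w j) = \sum_i w i * complex.Re (omega R N ^+ (i * j)).
Proof.
rewrite (big_morph (@complex.Re R) (id1 := 0) (op1 := +%R)) //; last by case=> ? ? [].
by apply: eq_bigr => i _; case: (omega R N ^+ _) => a b /=; rewrite mul0r subr0.
Qed.

Lemma Re_eigval_lt1 (R : realType) N (w : 'I_N -> R) j :
  (forall i, 0 <= w i) -> gathering (cld_matrix w) -> (0 < j < N)%N ->
  complex.Re (eigval w j) < 1.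
Proof.
move=> hw hg /andP[j0 jN].
have N0 : (0 < N)%N by apply: leq_ltn_trans jN.
have w1 := rowsum1 N0 hg.
rewrite ltNge; apply/negP => l1.
(* These nonnegative terms sum to [1 - Re lambda_j], so a rate of at least 1 makes all of them
   vanish. *)
have t0 i : 0 <= w i * (1 - complex.Re (omega R N ^+ (i * j))).
  by rewrite mulr_ge0 // subr_ge0 Re_omega_le1.
have s0 : \sum_i w i * (1 - complex.Re (omega R N ^+ (i * j))) = 0.
  apply/eqP; rewrite eq_le sumr_ge0 ?andbT //.
  under eq_bigr do rewrite mulrBr mulr1.
  by rewrite sumrB -Re_eigval w1 subr_le0.
(* For each [i], either [w i = 0] or [omega ^+ (i * j) = 1], so [lambda_j] equals the sum of the
   weights. *)
have le1 : eigval w j = 1.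
  have <- : (\sum_i w i)%:C%C = 1 by rewrite w1.
  rewrite rmorph_sum; apply: eq_bigr => i _ /=.
  have /eqP := psumr_eq0P (fun i _ => t0 i) s0 (i := i) isT.
  rewrite mulf_eq0 => /orP[/eqP->|]; first by rewrite mul0r.
  by rewrite subr_eq0 => /eqP/esym/Re_omega_eq1 ->; rewrite mulr1.
have A0 : cld_matrix w *m comb N j 1 0 0 0 = 0.
  rewrite /cld_matrix (cld_comb _ _ _ _ (eigvecP w j)) le1 /= /comb.
  by rewrite subrr !(mul0r, subr0, addr0, scale0r) col_mx0.
have [|xs [ys hx]] := hg.1 (fun=> comb N j 1 0 0 0).
  split; last exact: cvg_cst.
  by move=> t _; rewrite A0; exact: is_derive_cst.
have v (i : 'I_N) : complex.Re (omega R N ^+ (j * i)) = xs.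
  have [+ _] := hx i.
  rewrite /xpos /comb col_mxKu !mxE mul0r addr0 mul1r => /cvg_lim <- //.
  by rewrite lim_cst.
(* Robot 0 shows that the common value is 1; robot 1 then gives [omega ^+ j = 1], impossible for
   [0 < j < N]. *)
have v1 : xs = 1 by rewrite -(v (Ordinal N0)) muln0 expr0.
have N1 : (1 < N)%N by apply: leq_ltn_trans jN.
have /Re_omega_eq1/eqP := etrans (v (Ordinal N1)) v1.
rewrite muln1 -(prim_order_dvd (omega_prim R N0)) gtnNdvd //.
Qed.

Lemma Vj_stable (R : realType) N (w : 'I_N -> R) j :
  (forall i, 0 <= w i) -> gathering (cld_matrix w) -> (0 < j < N)%N ->
  stable_invariant (cld_matrix w) (Vj R N j) (complex.Re (eigval w j)).
Proof.
move=> hw hg jN; apply: stable_invariant_scalar_sym; first exact: Re_eigval_lt1.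
  by move=> x /(Vj_eig w)[].
by move=> x /(Vj_eig w)[].
Qed.

(** * Spanning by Fourier inversion *)

(** [v_l] and [v_l'] are conjugate. This folds indices above [N / 2] back, and makes [v_l] real when
    [l = l']. *)
Lemma reimV_refl (R : realType) N l l' : (l + l' = N)%N ->
  reV R N l = reV R N l' /\ imV R N l = - imV R N l'.
Proof.
move=> e; split; apply/matrixP => i m; rewrite !mxE;
  have N0 : (0 < N)%N := leq_ltn_trans (leq0n i) (ltn_ord i);
  rewrite (omega_conj R (m := l' * i) N0) -?mulnDl ?e ?dvdn_mulr //;
  by case: (omega R N ^+ _).
Qed.

Lemma omega_sum (R : realType) N n : (0 < N)%N ->
  \sum_(l < N) omega R N ^+ (l * n) = if (N %| n)%N then N%:R else 0.
Proof.
move=> N0; have p := omega_prim R N0.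
case: ifP => [dn|dn].
  have n1 : omega R N ^+ n = 1 by apply/eqP; rewrite -(prim_order_dvd p).
  under eq_bigr do rewrite mulnC exprM n1 expr1n.
  by rewrite sumr_const card_ord.
have n1 : omega R N ^+ n - 1 != 0 by rewrite subr_eq0 -(prim_order_dvd p) dn.
apply: (mulfI n1); rewrite mulr0.
under eq_bigr do rewrite mulnC exprM.
by rewrite -subrX1 -exprM mulnC exprM omegaXN // expr1n subrr.
Qed.

Lemma fourier_inv (R : realType) N (X : 'cV[R]_N) :
  exists a b : 'I_N -> R, X = \sum_(l < N) (a l *: reV R N l + b l *: imV R N l).
Proof.
have [N0|N0] := posnP N.
  exists (fun=> 0), (fun=> 0); apply/matrixP => i j.
  by exfalso; move: (ltn_ord i); rewrite {2}N0.
(* [f] is the discrete Fourier transform of [X], with [N - m] standing for [- m]. The coefficients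
   below come from the real part of [f l *: v_l], divided by [N]. *)
pose f (l : 'I_N) : R[i] := \sum_(m < N) (X m 0)%:C%C * omega R N ^+ (l * (N - m)).
exists (fun l => complex.Re (f l) / N%:R), (fun l => - complex.Im (f l) / N%:R).
have fE (i : 'I_N) : \sum_l f l * omega R N ^+ (l * i) = N%:R * (X i 0)%:C%C.
  under eq_bigr do rewrite mulr_suml.
  rewrite exchange_big /=.
  rewrite (eq_bigr (fun m => (X m 0)%:C%C * (if m == i then N%:R else 0))).
    rewrite (bigD1 i) //= eqxx mulrC -[RHS]addr0; congr (_ + _).
    by apply: big1 => m /negbTE ->; rewrite mulr0.
  move=> m _; under eq_bigr do rewrite -mulrA -exprD -mulnDr.
  rewrite -mulr_sumr omega_sum //; congr (_ * _).
  have [->|mi] := eqVneq m i; first by rewrite subnK ?dvdnn // ltnW.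
  rewrite ifN //.
  (* [N - m + i] lies strictly between 0 and [2 * N], so the only multiple of [N] it can be is [N]
     itself. *)
  apply: contra mi => /dvdnP[q qe]; apply/eqP/val_inj => /=.
  have := ltn_ord i; have := ltn_ord m; move: qe.
  move: (nat_of_ord i) (nat_of_ord m) => x y; clear -N0.
  by case: q => [|[|q]]; nia.
apply/matrixP => i j; rewrite ord1 summxE {j}.
have := congr1 (@complex.Re R) (fE i).
rewrite (big_morph (@complex.Re R) (id1 := 0) (op1 := +%R)) //; last by case=> ? ? [].
have -> : complex.Re (N%:R * (X i 0)%:C%C) = N%:R * X i 0.
  by rewrite -[N%:R](rmorph_nat (real_complex R)) /= mul0r subr0.
have N1 : N%:R != 0 :> R by rewrite pnatr_eq0 -lt0n.
move=> h; apply: (mulfI N1); rewrite -h mulr_sumr; apply: eq_bigr => l _.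
rewrite !mxE; case: (f l) => c d; case: (omega R N ^+ _) => c' d' /=.
by field.
Qed.

Lemma span_full (R : realType) N k : (2 * k <= N <= (2 * k).+1)%N ->
  (V0 R N + \sum_(1 <= j < k.+1) Vj R N j)%VS = fullv.
Proof.
move=> hk; set U := (_ + _)%VS.
have VU j : (1 <= j <= k)%N -> (Vj R N j <= U)%VS.
  move=> jk; apply: subv_trans (addvSr _ _).
  by rewrite (big_rem j) ?mem_index_iota //= addvSl.
have cU (l : 'I_N) a b c d : comb N l a b c d \in U.
  have [l0|l0] := posnP l.
    apply: subvP (addvSl _ _) _ _; apply/V0P; exists a, c.
    rewrite /comb; congr col_mx; apply/matrixP => i j;
    by rewrite !mxE l0 mul0n expr0 /= mulr0 addr0 mulr1.
  have [lk|kl] := leqP l k.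
    by apply: subvP (VU l _) _ _; rewrite ?l0 //; apply/VjP; do 4!eexists.
  (* For [l > k], the reflected index [N - l] lies between 1 and [k] because [N <= 2 * k + 1]. *)
  have [e1 e2] := reimV_refl R (subnKC (ltnW (ltn_ord l))).
  apply: subvP (VU (N - l)%N _) _ _; first by have := ltn_ord l; lia.
  apply/VjP; exists a, (- b), c, (- d).
  by rewrite /comb e1 e2 !scalerN !scaleNr.
apply/vspaceP => Z; rewrite memvf -(vsubmxK Z).
have [a [b ->]] := fourier_inv (usubmx Z).
have [c [d ->]] := fourier_inv (dsubmx Z).
have -> : forall F G : 'I_N -> 'cV[R]_N,
    col_mx (\sum_l F l) (\sum_l G l) = \sum_l col_mx (F l) (G l).
  move=> F G; apply: (big_rec3 (fun x y z => col_mx x y = z)); first exact: col_mx0.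
  by move=> i x y z _ <-; rewrite add_col_mx.
by apply: memv_suml => l _; exact: cU.
Qed.

(** * Dimension count and conclusion *)

Lemma dim_V0_le (R : realType) N : (\dim (V0 R N) <= 2)%N.
Proof. exact: dim_span. Qed.

Lemma dim_Vj_le (R : realType) N j : (\dim (Vj R N j) <= 4)%N.
Proof. exact: dim_span. Qed.

(** The index [k] is its own reflection, so [v_k] is real and two generators suffice. *)
Lemma dim_Vj_half_le (R : realType) k : (\dim (Vj R (2 * k) k) <= 2)%N.
Proof.
have i0 : imV R (2 * k) k = 0.
  have [|_ e] := @reimV_refl R (2 * k) k k; first by rewrite mul2n addnn.
  apply/matrixP => i l; have := congr1 (fun x : 'cV[R]_(2 * k) => x i l) e.
  by rewrite !mxE; lra.
pose S := [:: col_mx (reV R (2 * k) k) 0; col_mx 0 (reV R (2 * k) k)].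
have /leq_trans -> // : (\dim (Vj R (2 * k) k) <= \dim <<S>>)%N.
  apply: dimvS; rewrite /Vj i0 oppr0; apply/span_subvP => v.
  by rewrite !inE => /or4P[] /eqP ->; rewrite memv_span // !inE eqxx ?orbT.
exact: dim_span.
Qed.

(** Turns the upper bounds on dimensions into equalities: no term can fall short without the total
    falling short. *)
Lemma sum_eq_of_leq (r : seq nat) (F G : nat -> nat) :
  {in r, forall j, F j <= G j}%N -> (\sum_(j <- r) G j <= \sum_(j <- r) F j)%N ->
  {in r, forall j, F j = G j}.
Proof.
move=> FG le j jr; apply/eqP; rewrite eqn_leq FG //=.
have := le; rewrite !(big_rem j jr) /= => {}le.
have : (\sum_(i <- rem j r) F i <= \sum_(i <- rem j r) G i)%N.
  by rewrite !big_seq; apply: leq_sum => i /mem_rem; exact: FG.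
by rewrite -(leq_add2l (F j)) => /(leq_trans le); rewrite leq_add2r.
Qed.

Unset Implicit Arguments.
Set Strict Implicit.

Theorem theorem4p8 (R : realType) (N k : nat) (hN : (0 < N)%N)
    (hk : N = (2 * k)%N \/ N = (2 * k).+1)
    (w : 'I_N -> R) (hw : forall i, 0 <= w i)
    (hg : gathering (cld_matrix w)) :
  [/\ forall j : nat,
        map_mx (real_complex R) (circ w) *m eigvec R N j =
        eigval w j *: eigvec R N j,
      forall j : nat, (1 <= j <= k)%N ->
        stable_invariant (cld_matrix w) (Vj R N j) (complex.Re (eigval w j)),
      directv (V0 R N + \sum_(1 <= j < k.+1) Vj R N j) /\
        (V0 R N + \sum_(1 <= j < k.+1) Vj R N j)%VS = fullv,
      [/\ \dim (V0 R N) = 2%N,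
          N = (2 * k).+1 ->
            forall j : nat, (1 <= j <= k)%N -> \dim (Vj R N j) = 4%N &
          N = (2 * k)%N ->
            \dim (Vj R N k) = 2%N /\
            forall j : nat, (1 <= j <= k.-1)%N -> \dim (Vj R N j) = 4%N] &
      (* the same subspaces serve every other gathering protocol *)
      forall w' : 'I_N -> R, (forall i, 0 <= w' i) ->
        gathering (cld_matrix w') ->
        forall j : nat, (1 <= j <= k)%N ->
          stable_invariant (cld_matrix w') (Vj R N j)
            (complex.Re (eigval w' j))].
Proof.
have hN2 : (2 * k <= N <= (2 * k).+1)%N by lia.
have jN j : (1 <= j <= k)%N -> (0 < j < N)%N by lia.
have full := span_full R hN2.
have dfull : \dim (V0 R N + \sum_(1 <= j < k.+1) Vj R N j) = (2 * N)%N.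
  by rewrite full dimvf /dim /= muln1 addnn mul2n.
(* The expected dimensions; for [1 <= j <= k] the value 2 occurs only at [j = k] with [N] even. *)
pose m j := if (2 * j == N)%N then 2%N else 4%N.
have mle j : (\dim (Vj R N j) <= m j)%N.
  rewrite /m; case: eqP => [<-|_]; [exact: dim_Vj_half_le|exact: dim_Vj_le].
have summ : (2 + \sum_(1 <= j < k.+1) m j = 2 * N)%N.
  case: hk => hk.
    have k0 : (0 < k)%N by lia.
    rewrite big_nat_recr //= {2}/m hk eqxx.
    rewrite (eq_big_nat _ _ (F2 := fun=> 4%N)) ?sum_nat_const_nat; first by lia.
    by move=> j jk; rewrite /m; case: eqP => //; lia.
  rewrite (eq_big_nat _ _ (F2 := fun=> 4%N)) ?sum_nat_const_nat; first by lia.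
  by move=> j jk; rewrite /m; case: eqP => //; lia.
have dsum : (\dim (V0 R N + \sum_(1 <= j < k.+1) Vj R N j)
    <= \dim (V0 R N) + \sum_(1 <= j < k.+1) \dim (Vj R N j))%N.
  apply: leq_trans (dimv_add_leqif _ _) _; rewrite leq_add2l.
  elim/big_rec2: _ => [|i x y _ le]; first by rewrite dimv0.
  by apply: leq_trans (dimv_add_leqif _ _) _; rewrite leq_add2l.
have summ2 : (\sum_(1 <= j < k.+1) \dim (Vj R N j) <= \sum_(1 <= j < k.+1) m j)%N.
  by apply: leq_sum => j _.
(* The chain [2 * N <= \dim V0 + \sum \dim Vj <= 2 + \sum m = 2 * N] collapses to equalities. *)
have d0 : \dim (V0 R N) = 2%N.
  by have := dim_V0_le R N; lia.
have dj j : (1 <= j <= k)%N -> \dim (Vj R N j) = m j.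
  move=> jk; apply: (sum_eq_of_leq (r := index_iota 1 k.+1) (F := fun j => \dim (Vj R N j))).
  - by move=> i _.
  - by lia.
  - by rewrite mem_index_iota.
split.
- exact: eigvecP.
- by move=> j /jN; exact: Vj_stable.
(* The sum is direct once the dimensions of the summands total at most that of the sum, here
   [2 * N]. *)
- split=> //; rewrite directvEgeq /=; lia.
- split=> // [e j jk|e].
    by rewrite dj // /m; case: eqP => //; lia.
  split; first by rewrite dj /m; [rewrite -e eqxx|lia].
  by move=> j jk; rewrite dj /m; [case: eqP => //; lia|lia].
- by move=> w' hw' hg' j /jN; exact: Vj_stable.
Qed.
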